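(* Let $\mathcal{M}$ be an MDP with absorbing target set $T$ and reward function $\mathbf{r}:T\to\mathbb{Q}$ satisfying the attraction assumption. Then memoryless randomizing strategies are sufficient for $\mathsf{MDP}^{\{\mathbb{E},\mathrm{VaR},\mathrm{CVaR}\}}_{\mathsf{r},\mathsf{single}}$: for every strategy $\sigma$ there is a memoryless (possibly randomizing) strategy $\sigma'$ with $\mathbb{E}^{\sigma'}[R^{\mathsf{r}}]\ge\mathbb{E}^{\sigma}[R^{\mathsf{r}}]$, $\mathrm{VaR}^{\sigma'}_q(R^{\mathsf{r}})\ge\mathrm{VaR}^{\sigma}_q(R^{\mathsf{r}})$ and $\mathrm{CVaR}^{\sigma'}_p(R^{\mathsf{r}})\ge\mathrm{CVaR}^{\sigma}_p(R^{\mathsf{r}})$ for all $p,q\in(0,1)$; in particular, whenever some strategy satisfies a given single-dimensional query with expectation, VaR and CVaR lower-bound constraints, some memoryless randomizing strategy does.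
   Context: An MDP $\mathcal{M}=(S,\mathsf{A},\mathsf{Av},\Delta,s_0)$ has finite state set $S$, finite action set $\mathsf{A}$, $\mathsf{Av}:S\to 2^{\mathsf{A}}\setminus\{\emptyset\}$ such that $\{\mathsf{Av}(s)\}$ partitions $\mathsf{A}$, transition function $\Delta:\mathsf{A}\to\mathcal{D}(S)$ and initial state $s_0$. A strategy is a triple $\sigma=(\sigma_u,\sigma_n,\alpha)$ over a countable memory set $\mathsf{M}$, with memory update $\sigma_u:\mathsf{A}\times S\times\mathsf{M}\to\mathcal{D}(\mathsf{M})$, next move $\sigma_n:S\times\mathsf{M}\to\mathcal{D}(\mathsf{A})$ (supported on $\mathsf{Av}(s)$) and initial memory distribution $\alpha$; it induces a probability measure $\mathbb{P}^\sigma$ on runs, and $\mathbb{E}^\sigma,\mathrm{VaR}^\sigma,\mathrm{CVaR}^\sigma$ are taken w.r.t. it. A strategy is memoryless if $\mathsf{M}$ is a singleton; ''randomizing'' means $\sigma_n$ may return non-Dirac distributions. Weighted reachability: target states are absorbing (every action available in $s\in T$ returns to $s$ with probability 1), and $R^{\mathsf{r}}(\rho)$ is the reward of the first target state visited by run $\rho$, or $0$ if none is visited. For a real random variable $X$ with CDF $F_X$ and $p\in(0,1)$: $\mathrm{VaR}_p(X)=\sup\{r\mid F_X(r)\le p\}$; with $v=\mathrm{VaR}_p(X)$, $\mathrm{CVaR}_p(X)=\frac1p\big(\int_{(-\infty,v)}x\,dF_X+(p-\mathbb{P}[X<v])v\big)$. The attraction assumption: (A1) $T$ is reached almost surely under every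 strategy, or (A2) $\mathbf{r}(s)\ge0$ for all $s\in T$. *)

(* Defs.v *)
From HB Require Import structures.
From mathcomp Require Import all_boot all_order all_algebra.
From mathcomp Require Import all_classical all_reals all_analysis.

Set Implicit Arguments.
Unset Strict Implicit.
Unset Printing Implicit Defensive.

Import Order.TTheory GRing.Theory Num.Theory.
Import numFieldNormedType.Exports.

Local Open Scope classical_set_scope.
Local Open Scope ring_scope.

Record dist (R : realType) (X : choiceType) := Dist {
  dist_val :> X -> R ;
  dist_ge0 : forall x, 0 <= dist_val x ;
  dist_sum1 : (\esum_(x in [set: X]) (dist_val x)%:E = 1)%E }.

(* The last two fields say that the family of the sets [avail s] partitions the
   actions: every action belongs to exactly one state. *)
Record mdp (R : realType) := MDP {
  state : finType ;
  action : finType ;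
  avail : state -> {set action} ;
  trans : action -> dist R state ;
  init : state ;
  avail_neq0 : forall s, avail s != finset.set0 ;
  avail_disjoint : forall a s t, a \in avail s -> a \in avail t -> s = t ;
  avail_cover : forall a, exists s, a \in avail s }.

Record strategy (R : realType) (M : mdp R) := Strategy {
  memory : countType ;
  update : action M -> state M -> memory -> dist R memory ;
  next_move : state M -> memory -> dist R (action M) ;
  init_memory : dist R memory ;
  next_move_avail : forall s m a, next_move s m a != 0 -> a \in avail s }.

Arguments update {R M} s a s' m : rename.
Arguments next_move {R M} s s' m : rename.

Definition memoryless (R : realType) (M : mdp R) (sigma : strategy M) :=
  exists m0 : memory sigma, forall m, m = m0.

Definition run (R : realType) (M : mdp R) : Type := nat -> state M * action M.

Section run_pointed.
Context (R : realType) (M : mdp R).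

Lemma run_inhabited : exists _ : run M, True.
Proof.
have /set0Pn[a _] := avail_neq0 (init M).
by exists (fun=> (init M, a)).
Qed.

HB.instance Definition _ := gen_eqMixin (run M).
HB.instance Definition _ := gen_choiceMixin (run M).
HB.instance Definition _ := isPointed.Build (run M) (sval (cid run_inhabited)).
End run_pointed.

Definition cylinder (R : realType) (M : mdp R)
    (w : seq (state M * action M)) : set (run M) :=
  [set rho | mkseq rho (size w) = w].

Definition run_space (R : realType) (M : mdp R) :=
  g_sigma_algebraType (range (@cylinder R M)).

HB.instance Definition _ (R : realType) (M : mdp R) :=
  Measurable.on (run_space M).

Section path_mass.
Context (R : realType) (M : mdp R) (sigma : strategy M).
Local Open Scope ereal_scope.

(* Probability that, after playing action [a] with current memory [m], the run
   continues with the state-action pairs [w]; the memory states met on the way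
   are summed out. *)
Fixpoint continuation_mass (a : action M) (m : memory sigma)
    (w : seq (state M * action M)) : \bar R :=
  if w is (s', a') :: w' then
    (trans a s')%:E *
    \esum_(m' in [set: memory sigma])
      ((update sigma a s' m m')%:E * (next_move sigma s' m' a')%:E *
       continuation_mass a' m' w')
  else 1.

(* Probability that a run starts with the state-action pairs [w]. *)
Definition path_mass (w : seq (state M * action M)) : \bar R :=
  if w is (s, a) :: w' then
    if s == init M then
      \esum_(m in [set: memory sigma])
        ((init_memory sigma m)%:E * (next_move sigma s m a)%:E *
         continuation_mass a m w')
    else 0
  else 1.

Lemma dist_sum1_fin (X : finType) (d : dist R X) : \sum_x (d x)%:E = 1.
Proof.
rewrite -[RHS](dist_sum1 d) esum_fset; first last.
- by move=> x _; rewrite lee_fin dist_ge0.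
- exact: finite_finset.
rewrite fsbig_finite /=; last exact: finite_finset.
have eqT : finmap.enum_fset (fset_set [set: X]) =i index_enum X.
  move=> x; rewrite mem_index_enum in_fset_set; last exact: finite_finset.
  exact: mem_setT.
apply: perm_big; apply: uniq_perm; first exact: index_enum_uniq.
  exact: finmap.fset_uniq.
by move=> x; rewrite eqT.
Qed.

Lemma continuation_mass_ge0 a m w : 0 <= continuation_mass a m w.
Proof.
elim: w a m => [//|[s' a'] w IH] a m /=.
rewrite mule_ge0 ?lee_fin ?dist_ge0//; apply: esum_ge0 => m' _.
by rewrite mule_ge0// -EFinM lee_fin mulr_ge0 ?dist_ge0.
Qed.

Lemma continuation_mass_rcons a m w :
  \sum_x continuation_mass a m (rcons w x) = continuation_mass a m w.
Proof.
elim: w a m => [|[s' a'] w IH] a m /=.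
  pose F s' a' := (trans a s')%:E * \esum_(m' in [set: memory sigma])
    ((update sigma a s' m m')%:E * (next_move sigma s' m' a')%:E * 1).
  rewrite (eq_bigr (fun x => F x.1 x.2)); last by case.
  rewrite -(pair_bigA _ F)/= {}/F.
  rewrite -[RHS](dist_sum1_fin (trans a)); apply: eq_bigr => s' _.
  rewrite -ge0_sume_distrr; last first.
    move=> a' _; apply: esum_ge0 => m' _.
    by rewrite mule1 -EFinM lee_fin mulr_ge0 ?dist_ge0.
  rewrite -esum_sum; last first.
    by move=> m' a' _ _; rewrite mule1 -EFinM lee_fin mulr_ge0 ?dist_ge0.
  rewrite (eq_esum (b := fun m' => (update sigma a s' m m')%:E)).
    by rewrite dist_sum1 mule1.
  move=> m' _; under eq_bigr do rewrite mule1.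
  rewrite -ge0_sume_distrr ?dist_sum1_fin ?mule1// => a' _.
  by rewrite lee_fin dist_ge0.
rewrite -ge0_sume_distrr; last first.
  move=> x _; apply: esum_ge0 => m' _.
  by rewrite mule_ge0 ?continuation_mass_ge0// -EFinM lee_fin mulr_ge0 ?dist_ge0.
congr (_ * _); rewrite -esum_sum; last first.
  move=> m' x _ _.
  by rewrite mule_ge0 ?continuation_mass_ge0// -EFinM lee_fin mulr_ge0 ?dist_ge0.
apply: eq_esum => m' _; rewrite -ge0_sume_distrr ?IH// => x _.
exact: continuation_mass_ge0.
Qed.

Lemma path_mass_ge0 w : 0 <= path_mass w.
Proof.
case: w => [//|[s a] w] /=; case: ifPn => // _; apply: esum_ge0 => m _.
by rewrite mule_ge0 ?continuation_mass_ge0// -EFinM lee_fin mulr_ge0 ?dist_ge0.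
Qed.

Lemma path_mass_rcons w : \sum_x path_mass (rcons w x) = path_mass w.
Proof.
case: w => [|[s a] w] /=.
  pose F s a := if s == init M then \esum_(m in [set: memory sigma])
    ((init_memory sigma m)%:E * (next_move sigma s m a)%:E * 1) else 0.
  rewrite (eq_bigr (fun x => F x.1 x.2)); last by case.
  rewrite -(pair_bigA _ F)/= {}/F.
  rewrite (bigD1 (init M))//= [X in _ + X]big1 ?adde0; last first.
    by move=> s /negbTE ->; rewrite big1.
  rewrite eqxx -esum_sum; last first.
    by move=> m' a' _ _; rewrite mule1 -EFinM lee_fin mulr_ge0 ?dist_ge0.
  rewrite -[RHS](dist_sum1 (init_memory sigma)); apply: eq_esum => m' _.
  under eq_bigr do rewrite mule1.
  rewrite -ge0_sume_distrr ?dist_sum1_fin ?mule1// => a' _.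
  by rewrite lee_fin dist_ge0.
case: ifPn => [_|_]; last by rewrite big1.
rewrite -esum_sum; last first.
  move=> m' x _ _.
  by rewrite mule_ge0 ?continuation_mass_ge0// -EFinM lee_fin mulr_ge0 ?dist_ge0.
apply: eq_esum => m' _; rewrite -ge0_sume_distrr ?continuation_mass_rcons// => x _.
exact: continuation_mass_ge0.
Qed.

Lemma path_mass_le1 w : path_mass w <= 1.
Proof.
elim/last_ind: w => [//|w x IH]; apply: le_trans IH.
rewrite -[leRHS]path_mass_rcons (bigD1 x)//= leeDl// sume_ge0// => y _.
exact: path_mass_ge0.
Qed.

End path_mass.
Section run_measure_existence.
Context (R : realType) (M : mdp R).
Local Notation K := (state M * action M)%type.
Variable p : seq K -> R.
Hypothesis p_ge0 : forall w, 0 <= p w.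
Hypothesis p_nil : p [::] = 1.
Hypothesis p_rcons : forall w, \sum_k p (rcons w k) = p w.

(* The words of length [n], taken in lexicographic order, cut [0, 1[ into
   consecutive intervals of lengths [p w]; a point [u] of [0, 1[ is mapped to
   the run whose prefixes are the words whose intervals contain [u].  Words are
   stored in reverse. *)
Let q (w : seq K) : R := p (rev w).
Let C (w : seq K) (i : nat) : R :=
  \sum_(k : K | (enum_rank k < i)%N) q (k :: w).
Let left_end := fix left_end (w : seq K) : R :=
  if w is k :: w' then left_end w' + C w' (enum_rank k) else 0.
Let I (w : seq K) : set R := [set` `[left_end w, left_end w + q w[].

Let q_ge0 w : 0 <= q w. Proof. exact: p_ge0. Qed.

Let C0 w : C w 0 = 0. Proof. by rewrite /C big_pred0. Qed.

Let C_card w : C w #|{: K}| = q w.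
Proof.
rewrite /C -[RHS]p_rcons; apply: eq_big => [k|k _]; first exact: ltn_ord.
by rewrite /q rev_cons.
Qed.

Let CS w (k : K) : C w (enum_rank k).+1 = C w (enum_rank k) + q (k :: w).
Proof.
rewrite /C (bigD1 k)//= addrC; congr (_ + _); apply: eq_bigl => j.
rewrite ltnS ltn_neqAle andbC; congr (_ && _).
by rewrite -(inj_eq enum_rank_inj).
Qed.

Let C_le w i j : (i <= j)%N -> C w i <= C w j.
Proof.
move=> ij; rewrite /C [leRHS](bigID (fun k : K => enum_rank k < i)%N)/=.
rewrite [X in _ <= X + _](_ : _ = C w i) ?lerDl ?sumr_ge0//.
apply: eq_bigl => k; have [ki|] := ltnP (enum_rank k) i; last by rewrite andbF.
by rewrite andbT (leq_trans ki ij).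
Qed.

Let I_nil : I [::] = [set` `[0, 1[].
Proof. by rewrite /I /q /= p_nil add0r. Qed.

Let I_sub k w : I (k :: w) `<=` I w.
Proof.
move=> u; rewrite /I/= !in_itv/= => /andP[lu ur]; apply/andP; split.
  by apply: le_trans lu; rewrite lerDl -(C0 w) C_le.
apply: (lt_le_trans ur); rewrite -addrA lerD2l -CS -(C_card w).
by apply: C_le; exact: ltn_ord.
Qed.

Let I_inj j k w u : I (j :: w) u -> I (k :: w) u -> j = k.
Proof.
wlog jk : j k / (enum_rank j <= enum_rank k)%N.
  move=> h Ij Ik; case/orP: (leq_total (enum_rank j) (enum_rank k)) => jk.
    exact: h.
  by apply/esym/h.
rewrite /I/= !in_itv/= => /andP[_ uj] /andP[uk _].
move: jk; rewrite leq_eqVlt => /orP[/eqP/ord_inj/enum_rank_inj//|jk].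
suff : u < u by rewrite ltxx.
apply: (lt_le_trans uj); apply: le_trans uk.
by rewrite -addrA lerD2l -CS C_le.
Qed.

Let I_ex w u : I w u -> exists k, I (k :: w) u.
Proof.
rewrite /I/= in_itv/= => /andP[wu uw].
have ex : exists i, u < left_end w + C w i.
  by exists #|{: K}|; rewrite C_card.
case: (ex_minnP ex) => [[|i]] ui min_i.
  by move: ui; rewrite C0 addr0 ltNge wu.
have iK : (i < #|{: K}|)%N by apply: min_i; rewrite C_card.
pose k := enum_val (Ordinal iK); exists k.
have ki : enum_rank k = i :> nat by rewrite /k enum_valK.
rewrite in_itv/= -addrA -CS ki ui andbT leNgt; apply/negP => /min_i.
by rewrite ltnn.
Qed.

Let k0 : K := (point : run M) 0%N.
Let pre (u : R) := fix pre (n : nat) : seq K :=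
  if n is n'.+1 then xget k0 [set k | I (k :: pre n') u] :: pre n' else [::].
Let run_of (u : R) : run_space M := fun n => head k0 (pre u n.+1).

Let pre_I u n : I [::] u -> I (pre u n) u.
Proof.
move=> u0; elim: n => [//|n IH] /=; have [k Ik] := I_ex IH.
exact: (@xgetPex _ k0 [set k | I (k :: pre u n) u] (ex_intro _ k Ik)).
Qed.

Let I_sub0 w : I w `<=` I [::].
Proof. by elim: w => [//|k w IH] u /I_sub /IH. Qed.

Let pre_size w u : I w u -> pre u (size w) = w.
Proof.
elim: w => [//|k w IH] Iu /=.
have e := IH (I_sub Iu); rewrite e; congr cons.
apply: (@I_inj _ _ w u) => //.
exact: (@xgetPex _ k0 [set k | I (k :: w) u] (ex_intro _ k Iu)).
Qed.

Let run_of_prefix u n : mkseq (run_of u) n = rev (pre u n).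
Proof.
elim: n => [//|n IH].
by rewrite -addn1 /mkseq iotaD map_cat -/(mkseq _ _) IH addn1 /= rev_cons cats1.
Qed.

Let run_of_cylinder w :
  run_of @^-1` cylinder w `&` [set` `[0, 1[] = I (rev w).
Proof.
rewrite -I_nil; apply/seteqP; split => [u [/= uw u0]|u Iu].
  move: uw; rewrite /cylinder/= run_of_prefix => <-; rewrite revK.
  exact: pre_I.
split; last exact: I_sub0 Iu.
by rewrite /cylinder/= run_of_prefix -(size_rev w) (pre_size Iu) revK.
Qed.

Let run_of_out u v : ~ I [::] u -> ~ I [::] v -> run_of u = run_of v.
Proof.
move=> u0 v0; apply/funext => n; rewrite /run_of /=.
by rewrite !xgetPN// => k; [apply: contra_not v0|apply: contra_not u0] => /I_sub0.
Qed.

Let measurable_run_of :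
  measurable_fun [set: measurableTypeR R] (run_of : measurableTypeR R -> _).
Proof.
pose G : set (set (run_space M)) := range (@cylinder R M).
apply: (@measurability _ _ _ _ _ _ G (erefl : measurable = <<s G>>)).
move=> _ [_ [w _ <-] <-].
rewrite setTI -(setIT (_ @^-1` _)) -(setUv (I [::])) setIUr I_nil.
rewrite run_of_cylinder; apply: measurableU; first exact: measurable_itv.
have [[u [uw u0]]|no] := pselect (exists u, (run_of @^-1` cylinder w) u /\ ~ I [::] u).
  rewrite (_ : _ `&` _ = ~` [set` `[0, 1[]); first exact: measurableC.
  apply/setIidPr => v; rewrite -I_nil => v0; rewrite /preimage/=.
  by rewrite (run_of_out v0 u0).
rewrite (_ : _ `&` _ = set0) // -subset0 => v [vw v0].
by apply: no; exists v; rewrite I_nil.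
Qed.

Let uniform_itv (a b : R) : 0 <= a -> a <= b -> b <= 1 ->
  uniform_prob (@ltr01 R) [set` `[a, b[] = (b - a)%:E.
Proof.
move=> a0 ab b1; rewrite /uniform_prob.
rewrite (eq_integral (cst 1%:E)); last first.
  move=> x; rewrite inE/= in_itv/= => /andP[ax xb]; rewrite /uniform_pdf.
  by rewrite (le_trans a0 ax) (le_trans (ltW xb) b1) subr0 invr1.
rewrite integral_cst//= mul1e lebesgue_measure_itv/= lte_fin.
by case: ltgtP ab => // ->; rewrite subrr.
Qed.

Lemma run_measure_of_mass : exists P : probability (run_space M) R,
  forall w, P (cylinder w) = (p w)%:E.
Proof.
pose mX := isMeasurableFun.Build _ _ (measurableTypeR R) (run_space M)
  run_of measurable_run_of.
pose X : {mfun measurableTypeR R >-> run_space M} := HB.pack run_of mX.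
exists (distribution (uniform_prob (@ltr01 R)) X) => w.
pose U : probability (measurableTypeR R) R := uniform_prob (@ltr01 R).
have mc : measurable (run_of @^-1` cylinder w : set (measurableTypeR R)).
  rewrite -[X in measurable X]setTI; apply: measurable_run_of => //.
  by apply: sub_sigma_algebra; exists w.
have U01 : U (~` [set` `[0, 1[]) = 0%E.
  by rewrite probability_setC//= uniform_itv// subr0 subee.
have Irange : 0 <= left_end (rev w) /\ left_end (rev w) + q (rev w) <= 1.
  elim: (rev w) => [|k v [l0 l1]]; first by rewrite /q/= p_nil add0r.
  split => /=; first by rewrite addr_ge0// -(C0 v) C_le.
  by apply: le_trans l1; rewrite -addrA lerD2l -CS -(C_card v) C_le.
change (U (run_of @^-1` cylinder w) = (p w)%:E).
rewrite -(setIT (_ @^-1` _)) -(setUv ([set` `[0, 1[] : set R)) setIUr.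
rewrite measureU//; last 3 first.
- exact: measurableI.
- by apply: measurableI => //; exact: measurableC.
- by rewrite setIACA setICr setI0.
rewrite run_of_cylinder [X in (_ + X)%E](_ : _ = 0%E) ?adde0; last first.
  apply/eqP; rewrite eq_le measure_ge0 andbT -U01; apply: le_measure => //.
  - by rewrite inE; apply: measurableI => //; exact: measurableC.
  - by rewrite inE; exact: measurableC.
case: Irange => l0 l1.
have h : left_end (rev w) <= left_end (rev w) + q (rev w) by rewrite lerDl.
have e : left_end (rev w) + q (rev w) - left_end (rev w) = p w.
  by rewrite addrAC subrr add0r /q revK.
by rewrite -e; exact: uniform_itv l0 h l1.
Qed.

End run_measure_existence.

Section run_prob.
Context (R : realType) (M : mdp R).

Lemma run_prob_exists (sigma : strategy M) :
  exists P : probability (run_space M) R,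
    forall w, P (cylinder w) = path_mass sigma w.
Proof.
have fin w : path_mass sigma w \is a fin_num.
  rewrite fin_numE -ltNye -ltey (lt_le_trans (ltNyr 0) (path_mass_ge0 _ _))/=.
  exact: le_lt_trans (path_mass_le1 _ _) (ltry 1).
have [||w|P PE] := @run_measure_of_mass R M (fine \o path_mass sigma).
- by move=> w; rewrite fine_ge0 ?path_mass_ge0.
- by [].
- by rewrite /= -path_mass_rcons sum_fine.
- by exists P => w; rewrite PE fineK.
Qed.

(* The cylinders form a pi-system generating the sigma-algebra, so [run_probE]
   determines this measure uniquely. *)
Definition run_prob (sigma : strategy M) : probability (run_space M) R :=
  sval (cid (run_prob_exists sigma)).

Lemma run_probE (sigma : strategy M) w :
  run_prob sigma (cylinder w) = path_mass sigma w.
Proof. exact: svalP (cid (run_prob_exists sigma)) w. Qed.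

End run_prob.

Section weighted_reachability.
Context (R : realType) (M : mdp R) (T : {set state M}) (r : state M -> rat).

Definition absorbing :=
  forall s, s \in T -> forall a, a \in avail s -> trans a s = 1.

Definition reaches : set (run_space M) :=
  [set rho | exists n, (rho n).1 \in T].

(* [r] is consulted on [T] only. *)
Definition reach_reward (rho : run_space M) : R :=
  if pselect (exists n, (rho n).1 \in T) is left h
  then ratr (r (rho (ex_minn h)).1) else 0.

Definition attraction :=
  (forall sigma : strategy M, run_prob sigma reaches = 1%E) \/
  (forall s, s \in T -> 0 <= r s).

Lemma measurable_prefix (A : set (run_space M)) n :
  (forall rho rho' : run_space M,
     (forall i, (i < n)%N -> rho i = rho' i) -> A rho -> A rho') ->
  measurable A.
Proof.
move=> An; pose F w : set (run_space M) :=
  [set rho | cylinder w rho /\ exists2 rho', A rho' & mkseq rho' n = w].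
have -> : A = \bigcup_w F w.
  apply/seteqP; split => [rho Arho|rho [w _ [rhow [rho' Arho' rho'w]]]].
    exists (mkseq rho n) => //; split; last by exists rho.
    by rewrite /cylinder/= size_mkseq.
  apply: An Arho' => i ni; move: rhow.
  rewrite /cylinder/= -rho'w size_mkseq => e.
  by have := congr1 (nth (rho' i) ^~ i) e; rewrite !nth_mkseq.
apply: countable_bigcupT_measurable => [|w]; first exact: countableP.
have [h|h] := pselect (exists2 rho', A rho' & mkseq rho' n = w).
  rewrite (_ : F w = cylinder w); last by apply/seteqP; split => [x []|x].
  by apply: sub_sigma_algebra; exists w.
by rewrite (_ : F w = set0)// -subset0 => x [].
Qed.

Lemma measurable_reaches : measurable reaches.
Proof.
rewrite (_ : reaches = \bigcup_n [set rho | (rho n).1 \in T]); last first.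
  by apply/seteqP; split => [rho [n]|rho [n]]; exists n.
apply: bigcupT_measurable => n; apply: (@measurable_prefix _ n.+1).
by move=> rho rho' /(_ n (ltnSn n)) /= ->.
Qed.

Lemma measurable_reach_reward : measurable_fun [set: run_space M] reach_reward.
Proof.
move=> _ Y _; rewrite setTI.
pose B n : set (run_space M) := [set rho | [/\ (rho n).1 \in T,
  (forall i, (i < n)%N -> (rho i).1 \notin T) & Y (ratr (r (rho n).1))]].
rewrite (_ : _ @^-1` Y = \bigcup_n B n `|` (~` reaches `&` [set _ | Y 0])).
  apply: measurableU.
    apply: bigcupT_measurable => n; apply: (@measurable_prefix _ n.+1).
    move=> rho rho' e [rn ri Yr]; rewrite /B/= -(e n (ltnSn n)); split => // i ni.
    by rewrite -e ?ri// ltnS ltnW.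
  apply: measurableI; first by apply: measurableC; exact: measurable_reaches.
  by apply: (@measurable_prefix _ 0).
apply/seteqP; split => rho; rewrite /preimage/= /reach_reward.
  case: pselect => [h|h] Yr; last by right.
  left; exists (ex_minn h) => //; move: Yr; case: ex_minnP => n nT min_n Yr.
  by split => // i ni; apply/negP => /min_n; rewrite leqNgt ni.
case=> [[n _ [nT iT Yr]]|[h Y0]]; case: pselect => // h'.
- case: ex_minnP => m mT min_m.
  suff -> : m = n by [].
  apply/eqP; rewrite eqn_leq min_m//= leqNgt.
  by apply/negP => /iT; rewrite mT.
- by exfalso; apply: h'; exists n.
Qed.

HB.instance Definition _ := isMeasurableFun.Build _ _ (run_space M) R
  reach_reward measurable_reach_reward.

End weighted_reachability.

Section risk_measures.
Context d (Omega : measurableType d) (R : realType) (P : probability Omega R).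
Variable X : {RV P >-> R}.

Definition VaR (p : R) : R := sup [set x | (cdf X x <= p%:E)%E].

Definition CVaR (p : R) : \bar R :=
  let v := VaR p in
  (p^-1%:E * ((\int[distribution P X]_(x in `]-oo, v[) x%:E) +
              (p%:E - P [set omega | (X omega < v)%R]) * v%:E))%E.

End risk_measures.

Section strategy_values.
Context (R : realType) (M : mdp R) (T : {set state M}) (r : state M -> rat).
Variable sigma : strategy M.

Definition reward_rv : {RV (run_prob sigma) >-> R} := @reach_reward R M T r.

Definition reach_E : \bar R := 'E_(run_prob sigma)[reward_rv]%E.

Definition reach_VaR (q : R) : R := VaR reward_rv q.

Definition reach_CVaR (p : R) : \bar R := CVaR reward_rv p.

Definition satisfies_query (e q v p c : R) : Prop :=
  [/\ (e%:E <= reach_E)%E, v <= reach_VaR q & (c%:E <= reach_CVaR p)%E].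

End strategy_values.

(* Main.v *)
(* For each target [t] let [hit t] be the probability that [t] is the first
   target met.  It suffices to find a memoryless strategy whose probabilities
   [hit t] are all at least those of the given strategy: under (A1) they then
   agree, since both families sum to 1, and under (A2) every reward only
   replaces the reward 0 of a run that never meets a target; in both cases the
   reward increases stochastically, and expectation, value at risk and
   conditional value at risk are monotone for the stochastic order.

   The expected numbers [y (s, a)] of plays of [a] in [s] before time [N] and
   before meeting [T] satisfy the flow inequalities
   [\sum_a y (s, a) <= (s == init) + inflow y s] for [s] outside [T], and
   [(t == init) + inflow y t] tends to [hit t].  As [N] grows [y] may diverge,
   because of end components, but feasible sets of linear systems are closed
   with respect to their right-hand sides, so some finite [y] satisfies the
   limit system.  The memoryless strategy playing [a] in [s] with probability
   proportional to [y (s, a)] does the job: unrolling the flow inequalities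
   bounds the inflow into [t] by the probability of meeting [t] first, up to
   the mass that a finite initial measure sends to [t] at a late time, which
   tends to 0. *)

Require Import Defs.
From mathcomp Require Import all_boot all_order all_algebra.
From mathcomp Require Import all_classical all_reals all_analysis.
From mathcomp Require Import ring lra.

Set Implicit Arguments.
Unset Strict Implicit.
Unset Printing Implicit Defensive.

Import Order.TTheory GRing.Theory Num.Theory.
Import numFieldNormedType.Exports.

Local Open Scope classical_set_scope.
Local Open Scope ring_scope.

(** * Finite systems of linear inequalities and limits of their right-hand sides *)

Section linear_systems.
Variable R : realFieldType.

(** Either list may be empty, so [z] is built by induction, clipped by one bound at a time. *)
Lemma exists_between (L U : seq R) :
  {in L & U, forall l u, l <= u} ->
  exists z, {in L, forall l, l <= z} /\ {in U, forall u, z <= u}.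
Proof.
elim: L => [_|l L IH LU].
  elim: U => [|u U [z [_ zU]]]; first by exists 0.
  exists (Num.min z u); split=> // x; rewrite inE => /predU1P[->|xU].
    by rewrite ge_min lexx orbT.
  by rewrite ge_min zU.
have [|z [zL zU]] := IH; first by move=> x u xL; apply: LU; rewrite inE xL orbT.
exists (Num.max z l); split=> [x|u uU].
  rewrite inE le_max => /predU1P[->|/zL ->//]; by rewrite lexx orbT.
by rewrite ge_max zU//= LU// inE eqxx.
Qed.

(* Fourier-Motzkin: the variable [x] is eliminated by the nonnegative
   combinations [l * (row i) + m * (row j)] in which its coefficient vanishes. *)
Lemma approx_feasible (V : eqType) (s : seq V) (I : finType)
    (a : I -> V -> R) (b : I -> R) : uniq s ->
  (forall e, 0 < e -> exists y : V -> R,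
     forall i, \sum_(x <- s) a i x * y x <= b i + e) ->
  exists y : V -> R, forall i, \sum_(x <- s) a i x * y x <= b i.
Proof.
elim: s I a b => [|x s IH] I a b.
  move=> _ ab; exists (fun=> 0) => i; rewrite big_nil.
  apply/ler_addgt0Pr => e /ab[y /(_ i)]; by rewrite big_nil.
move=> /=/andP[xs us] ab.
pose pm (i j : I) := (0 < a i x) && (a j x < 0).
(* A pair rejected by [pm] copies row [k.1] when its coefficient at [x] vanishes, and gives the zero
   row otherwise. *)
pose l (k : I * I) : R :=
  if pm k.1 k.2 then - a k.2 x else (a k.1 x == 0)%:R.
pose m (k : I * I) : R := if pm k.1 k.2 then a k.1 x else 0.
have l0 k : 0 <= l k.
  by rewrite /l; case: ifP => [/andP[_ /ltW]|//]; rewrite oppr_ge0.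
have m0 k : 0 <= m k by rewrite /m; case: ifP => [/andP[/ltW]|].
have lm k : l k * a k.1 x + m k * a k.2 x = 0.
  rewrite /l /m; case: ifP => _; first by ring.
  by have [->|_] := eqVneq (a k.1 x) 0; rewrite ?mulr0 !mul0r addr0.
pose a' k v := l k * a k.1 v + m k * a k.2 v.
pose b' k := l k * b k.1 + m k * b k.2.
have sumE k (y : V -> R) : \sum_(v <- s) a' k v * y v =
    l k * (\sum_(v <- s) a k.1 v * y v) + m k * (\sum_(v <- s) a k.2 v * y v).
  by rewrite !mulr_sumr -big_split/=; apply: eq_bigr => v _; rewrite /a'; ring.
have [e e0|y yP] := IH _ a' b' us.
  (* Combining two rows multiplies their error by [l k + m k]; [C] exceeds all these factors, so an
     initial error [e / C] ends below [e]. *)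
  pose C := 1 + \sum_k (l k + m k).
  have C0 : 0 < C by rewrite ltr_wpDr// sumr_ge0// => k _; rewrite addr_ge0.
  have [y yP] := ab (e / C) (divr_gt0 e0 C0); exists y => k.
  have := yP k.1; have := yP k.2; rewrite !big_cons sumE.
  set u1 := \sum_(v <- s) _ ; set u2 := \sum_(v <- s) _ => h2 h1.
  have le_e : (l k + m k) * (e / C) <= e.
    rewrite mulrA ler_pdivrMr// mulrC ler_wpM2l//; first exact: ltW.
    rewrite /C (bigD1 k)//= addrCA -[leLHS]addr0 lerD2l addr_ge0//.
    by rewrite sumr_ge0// => j _; rewrite addr_ge0.
  have := ler_wpM2l (l0 k) h1; have := ler_wpM2l (m0 k) h2.
  have := congr1 (fun t => t * y x) (lm k).
  rewrite /b'; lra.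
pose t i := b i - \sum_(v <- s) a i v * y v.
(* With [y] fixed, rows with negative coefficient bound the eliminated variable from below, rows
   with positive one from above; the combined row [(i, j)] says that these bounds are compatible. *)
have [|z [zL zU]] := @exists_between
    [seq t j / a j x | j <- enum I & a j x < 0]
    [seq t i / a i x | i <- enum I & 0 < a i x].
  move=> _ _ /mapP[j + ->] /mapP[i + ->].
  rewrite !mem_filter => /andP[aj _] /andP[ai _].
  have := yP (i, j); rewrite sumE /b' /l /m /pm/= ai aj/=.
  rewrite ler_pdivlMr// mulrAC ler_ndivrMr// /t.
  set u1 := \sum_(v <- s) _ ; set u2 := \sum_(v <- s) _; lra.
exists (fun v => if v == x then z else y v) => i.
rewrite big_cons eqxx (eq_big_seq (fun v => a i v * y v)); last first.
  by move=> v vs; case: eqP => // vx; rewrite vx (negbTE xs) in vs *.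
have [ai|ai|ai] := ltrgtP (a i x) 0.
- have /zL : t i / a i x \in [seq t j / a j x | j <- enum I & a j x < 0].
    by apply/mapP; exists i; rewrite // mem_filter ai mem_enum.
  by rewrite ler_ndivrMr// /t mulrC; lra.
- have /zU : t i / a i x \in [seq t i / a i x | i <- enum I & 0 < a i x].
    by apply/mapP; exists i; rewrite // mem_filter ai mem_enum.
  by rewrite ler_pdivlMr// /t mulrC; lra.
- have := yP (i, i); rewrite sumE /b' /l /m /pm/= ai ltxx eqxx/=.
  by rewrite mul0r; lra.
Qed.

End linear_systems.

(** * Subinvariant flows of a finite Markov chain stopped on [T] *)

Section subflow.
Variables (R : realType) (S : finType) (T : {set S}) (k : S -> S -> R).
Hypothesis k_ge0 : forall s s', 0 <= k s s'.
Hypothesis k_sum1 : forall s, \sum_s' k s s' = 1.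

(** One step of the chain killed after it meets [T]: mass in [T] moves no further, so iterates
    evaluated in [T] count first arrivals only. *)
Definition push (z : S -> R) (s' : S) : R := \sum_(s | s \notin T) z s * k s s'.

Lemma ler_push z1 z2 : (forall s, s \notin T -> z1 s <= z2 s) ->
  forall s, push z1 s <= push z2 s.
Proof. by move=> z12 s; apply: ler_sum => s' /z12 h; rewrite ler_wpM2r. Qed.

Lemma pushD z1 z2 s : push (fun s => z1 s + z2 s) s = push z1 s + push z2 s.
Proof. by rewrite -big_split; apply: eq_bigr => s' _; rewrite mulrDl. Qed.

Lemma sum_push z : \sum_s push z s = \sum_(s | s \notin T) z s.
Proof.
rewrite /push exchange_big/=; apply: eq_bigr => s _.
by rewrite -mulr_sumr k_sum1 mulr1.
Qed.

Lemma iter_push_ge0 z n : (forall s, 0 <= z s) -> forall s, 0 <= iter n push z s.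
Proof.
by move=> z0; elim: n => [//|n IH] s /=; apply: sumr_ge0 => s' _; rewrite mulr_ge0.
Qed.

(** Conservation of mass: what has been absorbed in [T] before time [N] and what is present at time
    [N] add up to the initial mass. *)
Lemma sum_iter_push z N : (forall s, 0 <= z s) ->
  \sum_(s in T) \sum_(n < N) iter n push z s <= \sum_s z s.
Proof.
move=> z0.
suff : \sum_(s in T) \sum_(n < N) iter n push z s + \sum_s iter N push z s
    = \sum_s z s.
  by move=> <-; rewrite lerDl sumr_ge0// => s _; exact: iter_push_ge0.
elim: N => [|N IH].
  by rewrite big1 ?add0r// => s _; rewrite big_ord0.
rewrite -IH; under eq_bigr do rewrite big_ord_recr/=.
rewrite big_split/= -addrA; congr (_ + _).
by rewrite sum_push [RHS](bigID [in T]).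
Qed.

(* Unrolling [z <= d + z k] puts all but the [n]-th push of [z] on the visits
   of the chain started at [d]; those remainders are summable on [T]. *)
Lemma subflow_le_visits (d z : S -> R) :
  (forall s, 0 <= z s) -> (forall s, s \notin T -> z s <= d s + push z s) ->
  forall t, t \in T -> forall e, 0 < e ->
  exists N, d t + push z t <= \sum_(n < N) iter n push d t + e.
Proof.
move=> z0 zd t tT e e0.
have unroll n s : s \notin T ->
    iter n push z s <= iter n push d s + iter n.+1 push z s.
  elim: n s => [|n IH] s sT /=; first exact: zd.
  by rewrite -pushD; apply: ler_push => s'; exact: IH.
have unroll_t n :
    d t + push z t <= \sum_(i < n.+1) iter i push d t + iter n.+1 push z t.
  elim: n => [|n IH]; first by rewrite big_ord1.
  apply: (le_trans IH); rewrite [in leRHS]big_ord_recr/= -addrA lerD2l -pushD.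
  by apply: ler_push => s'; exact: unroll.
(* If [N] successive remainders at [t] all exceeded [e], together they would exceed the total mass
   of [z], which bounds them. *)
have [N NP] : exists N, \sum_s z s < N%:R * e.
  exists (Num.Def.archi_bound ((\sum_s z s) / e)).
  rewrite -ltr_pdivrMr//; apply: archi_boundP; apply: divr_ge0 (ltW e0).
  exact: sumr_ge0.
have : \sum_(n < N.+1) iter n push z t <= \sum_s z s.
  apply: le_trans (sum_iter_push N.+1 z0); rewrite (bigD1 t)//= lerDl.
  by apply: sumr_ge0 => s _; apply: sumr_ge0 => n _; exact: iter_push_ge0.
have [/existsP[n ne]|] := boolP [exists n : 'I_N, iter n.+1 push z t <= e].
  by move=> _; exists n.+1; apply: (le_trans (unroll_t n)); rewrite lerD2l.
rewrite negb_exists => /forallP h; rewrite big_ord_recl/= => le_z.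
suff : N%:R * e <= \sum_(i < N) push (iter i push z) t.
  move=> le_N; have h0 := z0 t; lra.
rewrite mulr_natl -[N in e *+ N]card_ord -sumr_const.
by apply: ler_sum => n _; rewrite ltW// ltNge; exact: h.
Qed.

End subflow.

(** * Variational form of the conditional value at risk for a finite law *)

Section cvar_maximizes.
Variables (R : realType) (O : finType) (w x : O -> R).
Hypothesis w_ge0 : forall o, 0 <= w o.
Hypothesis w_sum1 : \sum_o w o = 1.

(* The Rockafellar-Uryasev functional: [p] times the conditional value at risk
   is its maximum over [c], attained at the value at risk. *)
Definition ru (p c : R) : R := p * c - \sum_o w o * Num.max (c - x o) 0.

Definition fcdf (c : R) : R := \sum_(o | x o <= c) w o.

(** [ru] is concave in [c] with slope [p - fcdf]: the slope at the right end bounds an increment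
    from below, and in [ru_decr] the slope at the left end bounds it from above. *)
Lemma ru_incr p c c' : c <= c' ->
  (p - fcdf c') * (c' - c) <= ru p c' - ru p c.
Proof.
move=> cc'; rewrite /ru /fcdf.
suff : \sum_o w o * Num.max (c' - x o) 0 - \sum_o w o * Num.max (c - x o) 0
   <= (\sum_(o | x o <= c') w o) * (c' - c) by lra.
rewrite -sumrB mulr_suml [leRHS]big_mkcond/=; apply: ler_sum => o _.
rewrite -mulrBr; case: ifPn => xo.
  rewrite ler_wpM2l//; rewrite !maxEle; case: ifPn; case: ifPn; lra.
rewrite -ltNge in xo.
by rewrite !max_r ?subrr ?mulr0//; lra.
Qed.

Lemma ru_decr p c c' : c <= c' ->
  ru p c' - ru p c <= (p - fcdf c) * (c' - c).
Proof.
move=> cc'; rewrite /ru /fcdf.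
suff : (\sum_(o | x o <= c) w o) * (c' - c) <=
  \sum_o w o * Num.max (c' - x o) 0 - \sum_o w o * Num.max (c - x o) 0 by lra.
rewrite -sumrB mulr_suml [leLHS]big_mkcond/=; apply: ler_sum => o _.
rewrite -mulrBr; case: ifPn => xo.
  rewrite ler_wpM2l//; rewrite !maxEle; case: ifPn; case: ifPn; lra.
by rewrite mulr_ge0// !maxEle; case: ifPn; case: ifPn; lra.
Qed.

Lemma fcdf_ge0 c : 0 <= fcdf c. Proof. exact: sumr_ge0. Qed.

Lemma fcdf_le1 c : fcdf c <= 1.
Proof. by rewrite -w_sum1 [leRHS](bigID (fun o => x o <= c))/= lerDl sumr_ge0. Qed.

Lemma ru_max (p v : R) : 0 < p < 1 ->
  (forall c, c < v -> fcdf c <= p) -> (forall c, v < c -> p <= fcdf c) ->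
  forall c, ru p c <= ru p v.
Proof.
move=> p01 lo hi c; apply/ler_addgt0Pr => e e0.
have [cv|vc|->] := ltrgtP c v; last by lra.
(* The sign of the slope is known only strictly to the left of [v]; the last piece, from [u] to [v],
   has length at most [e / 2] and loses at most its length. The case to the right of [v] is
   symmetric. *)
- pose u := Num.max c (v - e / 2).
  have uv : u < v by rewrite gt_max cv/=; lra.
  have cu : c <= u by rewrite le_max lexx.
  have ue : v - e / 2 <= u by rewrite le_max lexx orbT.
  have h1 := ru_incr p cu; have h2 := ru_incr p (ltW uv).
  have h3 : 0 <= (p - fcdf u) * (u - c) by rewrite mulr_ge0 ?subr_ge0 ?lo.
  have h4 : - (v - u) <= (p - fcdf v) * (v - u).
    by rewrite -mulN1r ler_wpM2r; have := fcdf_le1 v; lra.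
  lra.
- pose u := Num.min c (v + e / 2).
  have uv : v < u by rewrite lt_min vc/=; lra.
  have cu : u <= c by rewrite ge_min lexx.
  have ue : u <= v + e / 2 by rewrite ge_min lexx orbT.
  have h1 := ru_decr p cu; have h2 := ru_decr p (ltW uv).
  have h3 : (p - fcdf u) * (c - u) <= 0.
    by rewrite mulr_le0_ge0 ?subr_le0 ?subr_ge0 ?hi.
  have h4 : (p - fcdf v) * (u - v) <= 1 * (u - v).
    by rewrite ler_wpM2r; have := fcdf_ge0 v; lra.
  lra.
Qed.

Lemma fcdf_le c c' : c <= c' -> fcdf c <= fcdf c'.
Proof.
move=> cc'; rewrite /fcdf [leLHS]big_mkcond [leRHS]big_mkcond/=.
by apply: ler_sum => o _; case: ifP => [xo|_]; [rewrite (le_trans xo cc')|case: ifP].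
Qed.

Lemma has_sup_fcdf (p : R) : 0 <= p < 1 -> has_sup [set c | fcdf c <= p].
Proof.
(* [B] bounds all values, so [fcdf] is 0 below [- B] and 1 above [B]. *)
move=> /andP[p0 p1]; pose B := \sum_o `|x o|.
have xB o : `|x o| <= B by rewrite /B (bigD1 o)//= lerDl sumr_ge0.
split.
  exists (- B - 1); rewrite /= /fcdf big_pred0// => o; apply/negbTE.
  by rewrite -ltNge; have := xB o; rewrite ler_norml; lra.
exists B => c /= cp; rewrite leNgt; apply/negP => Bc.
suff : fcdf c = 1 by lra.
rewrite /fcdf -w_sum1; apply: eq_bigl => o.
by rewrite (le_trans (ler_norm _))// (le_trans (xB o))// ltW.
Qed.

(** The supremum that defines the value at risk is a two-sided quantile, as [ru_max] requires. *)
Lemma ru_max_sup (p c : R) : 0 < p < 1 ->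
  ru p c <= ru p (sup [set c' | fcdf c' <= p]).
Proof.
move=> p01; have hs : has_sup [set c | fcdf c <= p].
  by apply: has_sup_fcdf; lra.
apply: ru_max => // d hd.
  have [d' /= d'p /ltW dd'] := sup_gt hs.1 hd.
  exact: le_trans (fcdf_le dd') d'p.
rewrite leNgt; apply/negP => dp; move: hd; rewrite ltNge => /negP; apply.
by apply: ub_le_sup; [exact: hs.2|exact: ltW].
Qed.

End cvar_maximizes.

(** * Masses of finite words under an arbitrary strategy *)

Lemma esumZl (R : realType) (I : choiceType) (D : set I) (c : R) (f : I -> \bar R) :
  0 <= c -> (forall i, 0 <= f i)%E ->
  (\esum_(i in D) (c%:E * f i) = c%:E * \esum_(i in D) f i)%E.
Proof.
move=> c0 f0.
(* One inequality suffices: for [c != 0] the converse is its instance with factor [c^-1] and family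
   [c * f]. *)
have le b (g : I -> \bar R) : 0 <= b -> (forall i, 0 <= g i)%E ->
    (\esum_(i in D) (b%:E * g i) <= b%:E * \esum_(i in D) g i)%E.
  move=> b0 g0; apply: ge_ereal_sup => _ [X XD <-].
  rewrite -ge0_mule_fsumr// lee_wpmul2l ?lee_fin//.
  by apply: ereal_sup_ubound; exists X.
apply/eqP; rewrite eq_le le//=.
have [->|cn0] := eqVneq c 0.
  by rewrite mul0e esum_ge0// => i _; rewrite mul0e.
have cf i : (f i = c^-1%:E * (c%:E * f i))%E.
  by rewrite muleA -EFinM mulVf// mul1e.
rewrite [in leLHS](eq_esum (fun i _ => cf i)).
apply: (le_trans (lee_wpmul2l _ (le _ _ _ _))); rewrite ?lee_fin ?invr_ge0//.
  by move=> i; rewrite mule_ge0 ?lee_fin.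
by rewrite muleA -EFinM mulfV// mul1e.
Qed.

Section path_masses.
Context (R : realType) (M : mdp R).
Local Notation K := (state M * action M)%type.

(** Grown at the end, so that the last state-action pair can be split off. *)
Fixpoint words (n : nat) : seq (seq K) :=
  if n is n'.+1 then [seq rcons w k | w <- words n', k <- index_enum K]
  else [:: [::]].

Lemma mem_words n w : (w \in words n) = (size w == n).
Proof.
elim: n w => [|n IH] w; first by rewrite inE size_eq0.
apply/allpairsP/eqP => [[[v k] [/= + _ ->]]|].
  by rewrite IH size_rcons => /eqP ->.
case/lastP: w => // w k; rewrite size_rcons => -[wn].
by exists (w, k); rewrite /= IH wn eqxx mem_index_enum.
Qed.

Lemma uniq_words n : uniq (words n).
Proof.
elim: n => [//|n IH]; apply: allpairs_uniq => //; first exact: index_enum_uniq.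
by move=> [v k] [w l] _ _ /= /rcons_inj[-> ->].
Qed.

Lemma measure_fibers d (Om : measurableType d) (mu : {measure set Om -> \bar R})
    (V : eqType) (f : Om -> V) (A : set Om) (s : seq V) :
  measurable A -> (forall v, measurable [set x | f x = v]) -> uniq s ->
  mu (A `&` [set x | f x \in s]) = (\sum_(v <- s) mu (A `&` [set x | f x = v]))%E.
Proof.
move=> mA mf; have ms (t : seq V) : measurable [set x | f x \in t].
  elim: t => [|v t IH].
    by rewrite (_ : mkset _ = set0)//; apply/seteqP; split.
  rewrite (_ : mkset _ = [set x | f x = v] `|` [set x | f x \in t]).
    exact: measurableU.
  apply/seteqP; split => x /=; rewrite inE.
    by case/predU1P; [left|right].
  by case=> [->|->]; rewrite ?eqxx ?orbT.
elim: s => [_|v s IH /=/andP[vs us]].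
  by rewrite big_nil (_ : mkset _ = set0) ?setI0//; apply/seteqP; split.
rewrite big_cons -IH// -measureU//; [|exact: measurableI|exact: measurableI|].
  rewrite -setIUr; congr (mu (_ `&` _)); apply/seteqP; split => x /=; rewrite inE.
    by case/predU1P; [left|right].
  by case=> [->|->]; rewrite ?eqxx ?orbT.
rewrite setIACA setIid -subset0 => x /= [_ [-> vs']].
by rewrite vs' in vs.
Qed.

Lemma cylinderE n w : size w = n ->
  [set rho : run_space M | mkseq rho n = w] = cylinder w.
Proof. by move=> <-. Qed.

Lemma measurable_mkseq n (p : pred (seq K)) :
  measurable [set rho : run_space M | p (mkseq rho n)].
Proof.
apply: (@measurable_prefix _ _ _ n) => rho rho' e /=.
rewrite (_ : mkseq rho n = mkseq rho' n)//.
apply: (@eq_from_nth _ (rho 0%N)); rewrite !size_mkseq// => i ni.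
by rewrite !nth_mkseq ?e.
Qed.

Variable sigma : strategy M.

Lemma run_prob_mkseq n (p : pred (seq K)) :
  run_prob sigma [set rho | p (mkseq rho n)] =
  (\sum_(w <- words n | p w) path_mass sigma w)%E.
Proof.
rewrite -[X in run_prob _ X]setIT.
rewrite (_ : setT = [set rho : run_space M | mkseq rho n \in words n]); last first.
  by apply/seteqP; split => // rho _ /=; rewrite mem_words size_mkseq.
rewrite measure_fibers ?uniq_words//; first last.
- move=> w; have := @measurable_mkseq n (pred1 w).
  by congr measurable; apply/seteqP; split => rho /= /eqP.
- exact: measurable_mkseq.
rewrite [RHS]big_mkcond/=; apply: eq_big_seq => w; rewrite mem_words => /eqP wn.
case: ifPn => pw.
  rewrite -run_probE -(cylinderE wn); congr (run_prob _ _).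
  by apply/seteqP; split => [rho []//|rho /= e]; rewrite e.
rewrite (_ : _ `&` _ = set0) ?measure0// -subset0 => rho /= [+ e].
by rewrite e (negbTE pw).
Qed.

Lemma path_mass_fin w : path_mass sigma w \is a fin_num.
Proof. by rewrite -run_probE fin_num_measure//; exact: sub_sigma_algebra. Qed.


(** Memory influences actions only: with the next action summed out, memory update and choice of
    action have total mass 1, and the transition out of the last action remains. *)
Lemma continuation_mass_next a m w s' :
  (\sum_a' continuation_mass (sigma := sigma) a m (rcons w (s', a')) =
   (trans (last a (unzip2 w)) s')%:E * continuation_mass a m w)%E.
Proof.
elim: w a m => [|[s1 a1] w IH] a m /=.
  rewrite -ge0_sume_distrr => [|a' _]; last first.
    by apply: esum_ge0 => m' _; rewrite mule1 -EFinM lee_fin mulr_ge0 ?dist_ge0.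
  congr (_ * _)%E; rewrite -esum_sum => [|m' a' _ _]; last first.
    by rewrite mule1 -EFinM lee_fin mulr_ge0 ?dist_ge0.
  rewrite -[RHS](dist_sum1 (update sigma a s' m)); apply: eq_esum => m' _.
  under eq_bigr do rewrite mule1.
  rewrite -ge0_sume_distrr ?dist_sum1_fin ?mule1// => a' _.
  by rewrite lee_fin dist_ge0.
have ge0 v a' m' : (0 <= (update sigma a s1 m m')%:E *
    (next_move sigma s1 m' a1)%:E * continuation_mass (sigma := sigma) a' m' v)%E.
  by rewrite mule_ge0 ?continuation_mass_ge0// -EFinM lee_fin mulr_ge0 ?dist_ge0.
rewrite -ge0_sume_distrr => [|a' _]; last by apply: esum_ge0.
rewrite muleCA -esumZl ?dist_ge0//; congr (_ * _)%E.
rewrite -esum_sum//; apply: eq_esum => m' _.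
rewrite -ge0_sume_distrr ?IH 1?muleCA// => a' _; exact: continuation_mass_ge0.
Qed.

Lemma path_mass_next w s a s' :
  (\sum_a' path_mass sigma (rcons (rcons w (s, a)) (s', a')) =
   (trans a s')%:E * path_mass sigma (rcons w (s, a)))%E.
Proof.
(* [path_mass] treats the first pair separately, so the head of the word has to be exposed. *)
suff gen s0 a0 v : (\sum_a' path_mass sigma ((s0, a0) :: rcons v (s', a')) =
    (trans (last a0 (unzip2 v)) s')%:E * path_mass sigma ((s0, a0) :: v))%E.
  case: w => [|[s0 a0] w]; first exact: (gen s a [::]).
  by have := gen s0 a0 (rcons w (s, a)); rewrite /unzip2 map_rcons last_rcons; apply.
move=> /=; case: ifPn => _; last by rewrite big1 ?mule0.
have ge0 u a' m' : (0 <= (init_memory sigma m')%:E * (next_move sigma s0 m' a0)%:E *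
    continuation_mass (sigma := sigma) a' m' u)%E.
  by rewrite mule_ge0 ?continuation_mass_ge0// -EFinM lee_fin mulr_ge0 ?dist_ge0.
rewrite -esumZl ?dist_ge0// -esum_sum//; apply: eq_esum => m' _.
rewrite -ge0_sume_distrr ?continuation_mass_next 1?muleCA// => a' _.
exact: continuation_mass_ge0.
Qed.

Lemma path_mass_unavailable w s a : a \notin avail s ->
  path_mass sigma (rcons w (s, a)) = 0%E.
Proof.
move=> sa; have nm m : next_move sigma s m a = 0.
  by apply/eqP; apply: contraNT sa; exact: next_move_avail.
have cm b m v : continuation_mass (sigma := sigma) b m (rcons v (s, a)) = 0%E.
  elim: v b m => [|[s1 a1] v IH] b m /=; rewrite esum1 ?mule0// => m' _.
    by rewrite nm mule0 mul0e.
  by rewrite IH mule0.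
case: w => [|[s0 a0] w] /=; case: ifP => // _; apply: esum1 => m _.
  by rewrite nm mule0 mul0e.
by rewrite cm mule0.
Qed.

Lemma path_mass_init s :
  (\sum_a path_mass sigma [:: (s, a)] = (s == init M)%:R%:E)%E.
Proof.
rewrite /=; have [_|_] := eqVneq s (init M); last by rewrite big1.
rewrite -esum_sum => [|m a _ _]; last first.
  by rewrite mule1 -EFinM lee_fin mulr_ge0 ?dist_ge0.
rewrite -[RHS](dist_sum1 (init_memory sigma)); apply: eq_esum => m _.
under eq_bigr do rewrite mule1.
rewrite -ge0_sume_distrr ?dist_sum1_fin ?mule1// => a' _.
by rewrite lee_fin dist_ge0.
Qed.

End path_masses.

(** * Strategies with one memory state *)

Section stationary_strategies.
Context (R : realType) (M : mdp R).

Lemma esum_unit (f : unit -> \bar R) :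
  (0 <= f tt)%E -> (\esum_(x in [set: unit]) f x = f tt)%E.
Proof.
move=> f0; rewrite (_ : setT = [set tt]) ?esum_set1//.
by apply/seteqP; split => // -[].
Qed.

Definition dist_unit : dist R unit :=
  Dist (fun=> ler01) (@esum_unit (fun=> 1%E) lee01).

Variable f : state M -> dist R (action M).
Hypothesis f_avail : forall s a, f s a != 0 -> a \in avail s.

Definition stationary : strategy M :=
  @Strategy R M unit (fun _ _ _ => dist_unit) (fun s _ => f s) dist_unit
    (fun s _ => @f_avail s).

(** The sum over [b] is the mass of arriving in [s']; with one memory state the action is then drawn
    from [f s'] independently of the past. *)
Lemma continuation_mass_stationary a m w s' a' :
  continuation_mass (sigma := stationary) a m (rcons w (s', a')) =
  ((\sum_b continuation_mass (sigma := stationary) a m (rcons w (s', b))) *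
   (f s' a')%:E)%E.
Proof.
rewrite continuation_mass_next.
elim: w a m => [|[s1 a1] w IH] a m /=.
  by rewrite esum_unit ?mule1 ?mul1e ?lee_fin ?dist_ge0.
rewrite !esum_unit ?mul1e; last 2 first.
- by rewrite mule_ge0 ?continuation_mass_ge0 ?lee_fin ?dist_ge0.
- by rewrite mule_ge0 ?continuation_mass_ge0 ?lee_fin ?dist_ge0.
by rewrite IH -!muleA [RHS]muleCA; congr (_ * _)%E; exact: muleCA.
Qed.

Lemma path_mass_stationary w s a :
  (path_mass stationary (rcons w (s, a)) =
   (\sum_b path_mass stationary (rcons w (s, b))) * (f s a)%:E)%E.
Proof.
case: w => [|[s0 a0] w].
  rewrite path_mass_init /=; case: eqP => _; last by rewrite mul0e.
  by rewrite esum_unit ?mule1 ?mul1e ?lee_fin ?dist_ge0.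
rewrite /=; have [_|_] := eqVneq s0 (init M); last by rewrite big1 ?mul0e.
have ge0 v : (0 <= 1%:E * (f s0 a0)%:E *
    continuation_mass (sigma := stationary) a0 tt v)%E.
  by rewrite mul1e mule_ge0 ?continuation_mass_ge0 ?lee_fin ?dist_ge0.
rewrite esum_unit//; under eq_bigr do rewrite esum_unit//.
rewrite continuation_mass_stationary muleA; congr (_ * _)%E.
by rewrite ge0_sume_distrr// => b _; exact: continuation_mass_ge0.
Qed.

End stationary_strategies.

(** * Visits before [T] and first hits of targets *)

Section first_visits.
Context (R : realType) (M : mdp R) (T : {set state M}).
Local Notation K := (state M * action M)%type.

Definition avoids (w : seq K) := all (fun k => k.1 \notin T) w.

Lemma big_words_rcons (V : nmodType) n (F : seq K -> V) :
  \sum_(w <- words M n.+1 | avoids w) F w =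
  \sum_(w <- words M n | avoids w) \sum_(k | k.1 \notin T) F (rcons w k).
Proof.
rewrite big_mkcond big_allpairs_dep [RHS]big_mkcond/=; apply: eq_bigr => w _.
case: ifPn => Tw.
  rewrite [RHS]big_mkcond; apply: eq_bigr => k _.
  by rewrite /avoids all_rcons -/(avoids w) Tw andbT.
by rewrite big1// => k _; rewrite /avoids all_rcons -/(avoids w) (negbTE Tw) andbF.
Qed.

Lemma sum_outside (V : nmodType) (F : K -> V) :
  \sum_(k | k.1 \notin T) F k = \sum_(s | s \notin T) \sum_a F (s, a).
Proof.
by rewrite pair_big/=; apply: eq_big => -[s a]//=; rewrite andbT.
Qed.

Definition mass (sigma : strategy M) w : R := fine (path_mass sigma w).

Lemma massE sigma w : (mass sigma w)%:E = path_mass sigma w.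
Proof. by rewrite fineK// path_mass_fin. Qed.

Lemma mass_ge0 sigma w : 0 <= mass sigma w.
Proof. by rewrite fine_ge0// path_mass_ge0. Qed.

(* The index [n] counts steps, so the visit of [k] at time [n] is preceded by
   [n] state-action pairs, all of them outside [T]. *)
Definition visit (sigma : strategy M) (n : nat) (k : K) : R :=
  \sum_(w <- words M n | avoids w) mass sigma (rcons w k).

Definition arrive (sigma : strategy M) (n : nat) (s : state M) : R :=
  \sum_a visit sigma n (s, a).

Lemma visit_ge0 sigma n k : 0 <= visit sigma n k.
Proof. by apply: sumr_ge0 => w _; exact: mass_ge0. Qed.

Lemma arrive_ge0 sigma n s : 0 <= arrive sigma n s.
Proof. by apply: sumr_ge0 => a _; exact: visit_ge0. Qed.

Lemma visit_unavailable sigma n s a : a \notin avail s -> visit sigma n (s, a) = 0.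
Proof. by move=> sa; apply: big1 => w _; rewrite /mass path_mass_unavailable. Qed.

Lemma arrive0 sigma s : arrive sigma 0 s = (s == init M)%:R.
Proof.
apply: EFin_inj; rewrite -(path_mass_init sigma) -sumEFin; apply: eq_bigr => a _.
by rewrite /visit big_cons big_nil/= addr0 massE.
Qed.

(** The flow equation holds for every strategy, since [path_mass_next] leaves no trace of the
    memory. *)
Lemma arriveS sigma n s' :
  arrive sigma n.+1 s' = \sum_(k | k.1 \notin T) visit sigma n k * trans k.2 s'.
Proof.
rewrite /arrive /visit; under eq_bigr do rewrite big_words_rcons.
rewrite exchange_big/=; under eq_bigr do rewrite exchange_big/=.
under [RHS]eq_bigr do rewrite mulr_suml.
rewrite [RHS]exchange_big/=; apply: eq_bigr => w _; apply: eq_bigr => -[s a] _.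
apply: EFin_inj; rewrite -sumEFin mulrC EFinM massE -path_mass_next.
by apply: eq_bigr => a' _; rewrite massE.
Qed.

Definition step (f : state M -> dist R (action M)) (s s' : state M) : R :=
  \sum_a f s a * trans a s'.

Lemma sum_dist (X : finType) (d : dist R X) : \sum_x d x = 1.
Proof. by apply: EFin_inj; rewrite -sumEFin dist_sum1_fin. Qed.

Lemma step_ge0 f s s' : 0 <= step f s s'.
Proof. by apply: sumr_ge0 => a _; rewrite mulr_ge0 ?dist_ge0. Qed.

Lemma sum_step f s : \sum_s' step f s s' = 1.
Proof.
rewrite exchange_big/= -[RHS](sum_dist (f s)); apply: eq_bigr => a _.
by rewrite -mulr_sumr sum_dist mulr1.
Qed.

Lemma visit_stationary (f : state M -> dist R (action M))
    (fP : forall s a, f s a != 0 -> a \in avail s) n s a :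
  visit (stationary fP) n (s, a) = arrive (stationary fP) n s * f s a.
Proof.
rewrite /arrive /visit exchange_big/= mulr_suml; apply: eq_bigr => w _.
apply: EFin_inj; rewrite massE path_mass_stationary EFinM -sumEFin.
by congr (_ * _)%E; apply: eq_bigr => b _; rewrite massE.
Qed.

(** Visits factor through [f], so arrivals follow the chain [step f] killed on [T]. *)
Lemma arrive_stationary (f : state M -> dist R (action M))
    (fP : forall s a, f s a != 0 -> a \in avail s) n s :
  arrive (stationary fP) n s =
  iter n (push T (step f)) (fun s => (s == init M)%:R) s.
Proof.
elim: n s => [|n IH] s; first exact: arrive0.
rewrite arriveS /= /push sum_outside; apply: eq_bigr => s' _.
by rewrite -IH mulr_sumr; apply: eq_bigr => a _; rewrite visit_stationary mulrA.
Qed.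

(** For [s] in [T], [n] is the time of the first visit of [T]; such events are disjoint for distinct
    [n] or distinct [s]. *)
Definition first_hit (n : nat) (s : state M) : set (run_space M) :=
  [set rho | avoids (mkseq rho n) && ((rho n).1 == s)].

Definition hits (s : state M) : set (run_space M) := \bigcup_n first_hit n s.

(** The first-hit event as a predicate on prefixes, in the form that [run_prob_mkseq] takes;
    reversal exposes the last pair. *)
Let ends_at s (w : seq K) :=
  if rev w is k :: v then avoids (rev v) && (k.1 == s) else false.

Let first_hitE n s : first_hit n s = [set rho | ends_at s (mkseq rho n.+1)].
Proof.
by apply/seteqP; split => rho; rewrite /first_hit /ends_at /= mkseqS rev_rcons revK.
Qed.

Lemma measurable_first_hit n s : measurable (first_hit n s).
Proof. by rewrite first_hitE; exact: measurable_mkseq. Qed.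

Lemma measurable_hits s : measurable (hits s).
Proof. by apply: bigcupT_measurable => n; exact: measurable_first_hit. Qed.

Lemma run_prob_first_hit sigma n s :
  run_prob sigma (first_hit n s) = (arrive sigma n s)%:E.
Proof.
have -> : (arrive sigma n s)%:E = (\sum_(w <- words M n)
    if avoids w then \sum_a path_mass sigma (rcons w (s, a)) else 0)%E.
  rewrite /arrive /visit exchange_big/= big_mkcond/= -sumEFin.
  apply: eq_bigr => w _; case: ifP => // _; rewrite -sumEFin.
  by apply: eq_bigr => a _; rewrite massE.
rewrite first_hitE run_prob_mkseq big_mkcond big_allpairs_dep.
apply: eq_bigr => w _; rewrite /ends_at.
under eq_bigr do rewrite rev_rcons revK.
case: ifPn => Tw; last by rewrite big1.
have -> : (\sum_a path_mass sigma (rcons w (s, a)) =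
    \sum_(s' | s' == s) \sum_a path_mass sigma (rcons w (s', a)))%E.
  by rewrite big_pred1_eq.
rewrite -big_mkcond/= pair_big_dep/=.
by apply: eq_big => -[s' a]//=; rewrite andbT.
Qed.

Lemma first_hit_inj s n m rho : s \in T ->
  first_hit n s rho -> first_hit m s rho -> n = m.
Proof.
move=> sT; wlog nm : n m / (n <= m)%N.
  move=> h hn hm; case/orP: (leq_total n m) => nm; first exact: h.
  by apply/esym/h.
rewrite /first_hit/= => /andP[_ /eqP ns] /andP[/allP av _].
move: nm; rewrite leq_eqVlt => /orP[/eqP//|nm].
have /av : rho n \in mkseq rho m by apply/mapP; exists n; rewrite // mem_iota.
by rewrite ns sT.
Qed.

Definition hit (sigma : strategy M) (s : state M) : R :=
  fine (run_prob sigma (hits s)).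

Lemma hitE sigma s : (hit sigma s)%:E = run_prob sigma (hits s).
Proof. by rewrite fineK// fin_num_measure//; exact: measurable_hits. Qed.

Lemma hit_ge0 sigma s : 0 <= hit sigma s.
Proof. by rewrite fine_ge0. Qed.

Lemma sum_arrive_cvg sigma t : t \in T ->
  ((\sum_(0 <= n < N) (arrive sigma n t)%:E)%E @[N --> \oo] --> (hit sigma t)%:E).
Proof.
move=> tT; rewrite hitE.
under eq_fun do under eq_bigr do rewrite -run_prob_first_hit.
apply: measure_sigma_additive => [n|]; first exact: measurable_first_hit.
by move=> n m _ _ [rho [hn hm]]; exact: first_hit_inj tT hn hm.
Qed.

Lemma sum_arrive_le_hit sigma t N : t \in T ->
  \sum_(n < N) arrive sigma n t <= hit sigma t.
Proof.
move=> tT; rewrite -lee_fin -(cvg_lim _ (@sum_arrive_cvg sigma t tT))//.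
rewrite -(big_mkord xpredT (fun n => arrive sigma n t)) -sumEFin.
by apply: nneseries_lim_ge => n _ _; rewrite lee_fin arrive_ge0.
Qed.

(** Stated for all large [N], so that one truncation time serves all targets. *)
Lemma hit_approx sigma t e : t \in T -> 0 < e ->
  exists N0, forall N, (N0 <= N)%N ->
    hit sigma t <= \sum_(n < N) arrive sigma n t + e.
Proof.
move=> tT e0.
have : \forall N \near \oo,
    ((hit sigma t - e)%:E < \sum_(0 <= n < N) (arrive sigma n t)%:E)%E.
  have h : ((hit sigma t - e)%:E < (hit sigma t)%:E)%E.
    by rewrite lte_fin ltrBlDr ltrDl.
  exact: (@sum_arrive_cvg sigma t tT _ (open_ereal_gt' h)).
case=> N0 _ h; exists N0 => N /h; rewrite /= sumEFin big_mkord lte_fin.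
by move=> ?; lra.
Qed.

End first_visits.

(** * From a finite solution of the flow system to a memoryless strategy *)

Section memoryless_domination.
Context (R : realType) (M : mdp R) (T : {set state M}).
Local Notation K := (state M * action M)%type.

Lemma dist_of_sum1 (X : finType) (g : X -> R) :
  (forall x, 0 <= g x) -> \sum_x g x = 1 -> exists d : dist R X, forall x, d x = g x.
Proof.
move=> g0 g1.
have e : (\esum_(x in [set: X]) (g x)%:E = 1)%E.
  rewrite esum_fset; [|exact: finite_finset|by move=> x _; rewrite lee_fin].
  rewrite (_ : setT = [set` index_enum X]); last first.
    by apply/seteqP; split => // x _ /=; rewrite mem_index_enum.
  by rewrite -fsbig_seq ?index_enum_uniq// sumEFin g1.
by exists (Dist g0 e).
Qed.

Let live (k : K) := (k.2 \in avail k.1) && (k.1 \notin T).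
Let start (s : state M) : R := (s == init M)%:R.
Let inflow (y : K -> R) (s : state M) := \sum_(k | live k) y k * trans k.2 s.

Lemma sum_live (F : K -> R) :
  \sum_(k | live k) F k = \sum_(s | s \notin T) \sum_(a in avail s) F (s, a).
Proof.
by rewrite pair_big_dep/=; apply: eq_big => -[s a]//=; rewrite /live andbC.
Qed.

Lemma inflow_visit sigma N s :
  inflow (fun k => \sum_(n < N) visit T sigma n k) s =
  \sum_(n < N) arrive T sigma n.+1 s.
Proof.
rewrite /inflow; under eq_bigr do rewrite mulr_suml.
rewrite exchange_big/=; apply: eq_bigr => n _; rewrite arriveS.
rewrite [RHS](bigID (fun k => k.2 \in avail k.1))/= [X in _ = _ + X]big1.
  by rewrite addr0; apply: eq_bigl => k; rewrite /live andbC.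
by case=> s' a /andP[_ sa]; rewrite visit_unavailable// mul0r.
Qed.

Lemma sum_avail_visit sigma N s :
  \sum_(a in avail s) \sum_(n < N) visit T sigma n (s, a) =
  \sum_(n < N) arrive T sigma n s.
Proof.
rewrite exchange_big/=; apply: eq_bigr => n _; rewrite /arrive.
rewrite [RHS](bigID [in avail s])/= [X in _ = _ + X]big1 ?addr0//.
by move=> a sa; rewrite visit_unavailable.
Qed.

(* Truncated visit counts satisfy the flow inequalities up to an arbitrarily
   small error; their limit may be infinite inside end components, but the
   linear system itself has a finite solution. *)
Lemma exists_subflow (sigma : strategy M) : exists y : K -> R,
  [/\ forall s a, s \notin T -> a \in avail s -> 0 <= y (s, a),
      forall s, s \notin T -> \sum_(a in avail s) y (s, a) <= start s + inflow y s
    & forall t, t \in T -> hit T sigma t <= start t + inflow y t].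
Proof.
(* Row [inl k'] says that [y k'] is nonnegative; row [inr s] is the balance at [s] outside [T], and
   the lower bound on the inflow by [hit] at [s] in [T]. *)
pose a (i : K + state M) (k : K) : R := match i with
  | inl k' => - (k == k')%:R
  | inr s => (k.1 == s)%:R * (s \notin T)%:R - trans k.2 s end.
pose b (i : K + state M) : R := match i with
  | inl _ => 0
  | inr s => start s - (s \in T)%:R * hit T sigma s end.
have outE (y : K -> R) s :
    \sum_(k <- [seq k <- index_enum K | live k]) a (inr s) k * y k =
    (s \notin T)%:R * (\sum_(a in avail s) y (s, a)) - inflow y s.
  rewrite big_filter /a; under eq_bigr do rewrite mulrBl.
  rewrite sumrB; congr (_ - _); last by apply: eq_bigr => k _; rewrite mulrC.
  case: (boolP (s \notin T)) => sT /=; last first.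
    by rewrite mul0r big1// => k _; rewrite mulr0 mul0r.
  rewrite mul1r sum_live (bigD1 s)//= [X in _ + X]big1 ?addr0.
    by apply: eq_bigr => c _; rewrite eqxx !mul1r.
  by move=> s' /andP[_ /negbTE ss]; rewrite big1// => c _; rewrite ss !mul0r.
have nonnegE (y : K -> R) k :
    \sum_(k' <- [seq k <- index_enum K | live k]) a (inl k) k' * y k' =
    - ((live k)%:R * y k).
  rewrite big_filter /a; have [lk|lk] := boolP (live k).
    rewrite (bigD1 k)//= eqxx big1 ?addr0 ?mulN1r ?mul1r// => k' /andP[_ /negbTE ->].
    by rewrite oppr0 mul0r.
  rewrite mul0r oppr0 big1// => k' lk'; case: eqP => [e|_].
    by rewrite -e lk' in lk.
  by rewrite oppr0 mul0r.
have [||y yP] := @approx_feasible R K [seq k <- index_enum K | live k]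
  (K + state M)%type a b.
- by rewrite filter_uniq// index_enum_uniq.
- move=> e e0.
  have /choice[N0 N0P] : forall t, exists N0, t \in T -> forall N, (N0 <= N)%N ->
      hit T sigma t <= \sum_(n < N) arrive T sigma n t + e.
    move=> t; have [tT|_] := boolP (t \in T); last by exists 0%N.
    by have [N0 h] := hit_approx sigma tT e0; exists N0.
  pose N := \max_t N0 t.
  exists (fun k => \sum_(n < N) visit T sigma n k) => -[k|s].
    rewrite nonnegE /b add0r (le_trans _ (ltW e0))// oppr_le0 mulr_ge0//.
    by apply: sumr_ge0 => n _; exact: visit_ge0.
  rewrite outE inflow_visit sum_avail_visit /b /start -(arrive0 T sigma).
  (* Arrivals are counted up to time [N], plays only before [N]. The surplus is nonnegative, so the
     balance outside [T] holds exactly and the error [e] is spent on the targets. *)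
  have shift : arrive T sigma 0 s + \sum_(n < N) arrive T sigma n.+1 s =
      \sum_(n < N) arrive T sigma n s + arrive T sigma N s.
    have <- : \sum_(n < N.+1) arrive T sigma n s =
        \sum_(n < N) arrive T sigma n s + arrive T sigma N s.
      by rewrite big_ord_recr.
    by rewrite big_ord_recl.
  have aN := arrive_ge0 T sigma N s.
  have [sT|sT] := boolP (s \in T); rewrite /= ?mul0r ?mul1r; last by lra.
  have := N0P s sT N (leq_bigmax s); lra.
exists y; split=> [s c sT sc|s sT|t tT].
- by have := yP (inl (s, c)); rewrite nonnegE /b /live/= sc sT mul1r oppr_le0.
- have := yP (inr s); rewrite outE /b sT (negbTE sT) mul0r mul1r; lra.
- by have := yP (inr t); rewrite outE /b tT/= mul0r mul1r; lra.
Qed.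

Lemma memoryless_hit (sigma : strategy M) : exists sigma' : strategy M,
  memoryless sigma' /\ forall t, t \in T -> hit T sigma t <= hit T sigma' t.
Proof.
have [y [y0 yout yin]] := exists_subflow sigma.
(* The value 0 on [T] makes [z] nonnegative everywhere; the sign of [y] is known only outside
   [T]. *)
pose z s := if s \in T then 0 else \sum_(a in avail s) y (s, a).
have z0 s : 0 <= z s.
  by rewrite /z; case: ifPn => // sT; apply: sumr_ge0 => a; exact: y0.
have /choice[f fP] : forall s, exists d : dist R (action M),
    (forall a, d a != 0 -> a \in avail s) /\
    (forall a, s \notin T -> a \in avail s -> y (s, a) = z s * d a).
  (* Where [z] vanishes any available action will do: outside [T], the nonnegative [y (s, a)] sum to
     0 and hence vanish too. *)
  move=> s; have [zs|zs] := eqVneq (z s) 0.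
    have /set0Pn[a0 sa0] := avail_neq0 s.
    have [||d dE] := @dist_of_sum1 (action M) (fun a => (a == a0)%:R).
    - by move=> a.
    - by rewrite (bigD1 a0)//= eqxx big1 ?addr0// => a /negbTE ->.
    exists d; split=> a.
      by rewrite dE; case: (a =P a0) => [->//|_]; rewrite eqxx.
    move=> sT sa; rewrite zs mul0r; move: zs; rewrite /z (negbTE sT).
    by move/psumr_eq0P => -> // b sb; exact: y0.
  have sT : s \notin T by apply: contra zs; rewrite /z => ->.
  have [||d dE] := @dist_of_sum1 (action M)
    (fun a => if a \in avail s then y (s, a) / z s else 0).
  - by move=> a; case: ifPn => // sa; rewrite divr_ge0// y0.
  - rewrite -big_mkcond/= -mulr_suml.
    by move: zs; rewrite /z (negbTE sT) => zs; rewrite mulfV.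
  exists d; split=> a; first by rewrite dE; case: ifP => //; rewrite eqxx.
  by move=> _ sa; rewrite dE sa mulrCA mulfV ?mulr1.
have favail s a : f s a != 0 -> a \in avail s by case: (fP s) => h _; exact: h.
exists (stationary favail); split; first by exists tt => -[].
have inflowE s' : inflow y s' = push T (step f) z s'.
  rewrite /inflow sum_live; apply: eq_bigr => s sT; rewrite /step mulr_sumr.
  rewrite [RHS](bigID [in avail s])/= [X in _ = _ + X]big1 ?addr0.
    by apply: eq_bigr => a sa; rewrite (proj2 (fP s))// mulrA.
  move=> a sa; have [->|/favail] := eqVneq (f s a) 0; first by rewrite mul0r mulr0.
  by rewrite (negbTE sa).
move=> t tT; apply/ler_addgt0Pr => e e0.
have [|N NP] := subflow_le_visits (step_ge0 f) (sum_step f) z0 (d := start) _ tT e0.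
  by move=> s sT; rewrite -inflowE {1}/z (negbTE sT); exact: yout.
apply: (le_trans (yin t tT)); rewrite inflowE; apply: (le_trans NP).
rewrite lerD2r (le_trans _ (sum_arrive_le_hit _ N tT))//.
by apply: ler_sum => n _; rewrite arrive_stationary.
Qed.

End memoryless_domination.

(** * The finite law of the reward *)

Section reward_law.
Context (R : realType) (M : mdp R) (T : {set state M}) (r : state M -> rat).
Implicit Types (sigma : strategy M) (g : R -> R).

Lemma reach_reward_hits (rho : run_space M) t :
  t \in T -> hits T t rho -> reach_reward T r rho = ratr (r t).
Proof.
move=> tT [n _ hn]; have /andP[/allP av /eqP nt] := hn.
rewrite /reach_reward; case: pselect => [h|]; last first.
  by case; exists n; rewrite nt.
case: ex_minnP => m mT min_m; suff -> : m = n by rewrite nt.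
apply/eqP; rewrite eqn_leq min_m ?nt// leqNgt; apply/negP => mn.
have /av : rho m \in mkseq rho n by apply/mapP; exists m; rewrite // mem_iota.
by rewrite mT.
Qed.

Lemma reaches_hits (rho : run_space M) :
  reaches T rho -> exists2 t, t \in T & hits T t rho.
Proof.
move=> h; have [n nT min_n] := ex_minnP h; exists (rho n).1 => //.
exists n => //; rewrite /first_hit/= eqxx andbT; apply/allP => k /mapP[i].
rewrite mem_iota /= add0n => ni ->; apply/negP => /min_n.
by rewrite leqNgt ni.
Qed.

Lemma hits_inj (rho : run_space M) s t : s \in T -> t \in T ->
  hits T s rho -> hits T t rho -> s = t.
Proof.
move=> sT tT [n _ hn] [m _ hm].
move: hn hm; rewrite /first_hit/= => /andP[/allP avn /eqP ns].
move=> /andP[/allP avm /eqP mt].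
have [nm|mn|nm] := ltngtP n m; last by rewrite -ns -mt nm.
- have /avm : rho n \in mkseq rho m by apply/mapP; exists n; rewrite // mem_iota.
  by rewrite ns sT.
- have /avn : rho m \in mkseq rho n by apply/mapP; exists m; rewrite // mem_iota.
  by rewrite mt tT.
Qed.

Lemma sum_indic_hits (c : state M -> R) (rho : run_space M) t :
  t \in T -> hits T t rho -> \sum_(s in T) c s * \1_(hits T s) rho = c t.
Proof.
move=> tT ht; rewrite (bigD1 t)//= [X in _ + X]big1 ?addr0.
  by rewrite indicE mem_set// mulr1.
move=> s /andP[sT st]; rewrite indicE memNset ?mulr0// => hs.
by rewrite (hits_inj sT tT hs ht) eqxx in st.
Qed.

Lemma sum_indic_nohits (c : state M -> R) (rho : run_space M) :
  ~ reaches T rho -> \sum_(s in T) c s * \1_(hits T s) rho = 0.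
Proof.
move=> h; rewrite big1// => s sT; rewrite indicE memNset ?mulr0// => -[n _].
by move=> /andP[_ /eqP ns]; apply: h; exists n; rewrite ns.
Qed.

Let integrable_indic_hits sigma t :
  (run_prob sigma).-integrable setT (fun rho => (\1_(hits T t) rho)%:E).
Proof. by apply: integrable_indic; exact: measurable_hits. Qed.

Let sum_hitsE (c : state M -> R) :
  (fun rho : run_space M => (\sum_(t in T) c t * \1_(hits T t) rho)%:E) =
  (fun rho => \sum_(t in T) (c t)%:E * (\1_(hits T t) rho)%:E)%E.
Proof.
by apply/funext => rho; rewrite -sumEFin; apply: eq_bigr => t _; rewrite EFinM.
Qed.

Lemma integrable_hits sigma (c : state M -> R) :
  (run_prob sigma).-integrable setT
    (fun rho => (\sum_(t in T) c t * \1_(hits T t) rho)%:E).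
Proof.
rewrite sum_hitsE; apply: integrable_sum => // t _.
exact: integrableZl (integrable_indic_hits _ _).
Qed.

Lemma integral_hits sigma (c : state M -> R) :
  (\int[run_prob sigma]_rho (\sum_(t in T) c t * \1_(hits T t) rho)%:E =
   (\sum_(t in T) c t * hit T sigma t)%:E)%E.
Proof.
rewrite sum_hitsE integral_sum// => [|t]; last first.
  exact: integrableZl (integrable_indic_hits _ _).
rewrite -sumEFin; apply: eq_bigr => t _; rewrite EFinM hitE.
rewrite (integralZl measurableT (integrable_indic_hits _ _)).
by rewrite integral_indic// ?setIT//; exact: measurable_hits.
Qed.

Lemma sum_hit sigma :
  ((\sum_(t in T) hit T sigma t)%:E = run_prob sigma (reaches T))%E.
Proof.
have := integral_hits sigma (fun=> 1).
under [in X in _ = X -> _]eq_bigr do rewrite mul1r.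
move=> <-; rewrite -[X in run_prob _ X]setIT -integral_indic//; last first.
  exact: measurable_reaches.
apply: eq_integral => rho _; congr EFin; rewrite indicE.
have [h|h] := pselect (reaches T rho).
  by have [t tT ht] := reaches_hits h; rewrite (sum_indic_hits _ tT ht) mem_set.
by rewrite sum_indic_nohits// memNset.
Qed.

(* The law of the reward is carried by [0] and the values of the targets;
   the outcome [None] stands for the runs that never reach [T]. *)
Definition outcome (o : option (state M)) : R :=
  if o is Some t then ratr (r t) else 0.

Definition law sigma (o : option (state M)) : R :=
  if o is Some t then (if t \in T then hit T sigma t else 0)
  else 1 - \sum_(t in T) hit T sigma t.

Lemma law_ge0 sigma o : 0 <= law sigma o.
Proof.
case: o => [t|] /=; first by case: ifP => // _; exact: hit_ge0.
by rewrite subr_ge0 -lee_fin sum_hit probability_le1//; exact: measurable_reaches.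
Qed.

Lemma big_option (V : nmodType) (S : finType) (F : option S -> V) :
  \sum_o F o = F None + \sum_s F (Some s).
Proof.
rewrite (bigD1 None)//=; congr (_ + _).
rewrite (reindex_omap Some id)/=; last by case.
by apply: eq_bigl => s; rewrite eqxx.
Qed.

Lemma sum_law sigma : \sum_o law sigma o = 1.
Proof. by rewrite big_option /= -big_mkcond/= subrK. Qed.

Definition mean sigma g : R := \sum_o law sigma o * g (outcome o).

(** Hitting [t] replaces the default value [g 0] by [g (ratr (r t))]; in this form the dependence on
    the hitting probabilities is linear. *)
Lemma meanE sigma g :
  mean sigma g = g 0 + \sum_(t in T) (g (ratr (r t)) - g 0) * hit T sigma t.
Proof.
rewrite /mean big_option/= mulrBl mul1r -addrA; congr (_ + _).
under [X in _ = X]eq_bigr do rewrite mulrBl.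
rewrite sumrB addrC mulr_suml; congr (_ - _); last first.
  by apply: eq_bigr => t _; rewrite mulrC.
rewrite [RHS]big_mkcond/=; apply: eq_bigr => t _.
by case: ifP => _; rewrite ?mul0r// mulrC.
Qed.

Lemma meanN sigma g : mean sigma (fun x => - g x) = - mean sigma g.
Proof. by rewrite /mean -sumrN; apply: eq_bigr => o _; rewrite mulrN. Qed.

(** At most one indicator is nonzero on a run, so functions of the reward are simple functions. *)
Lemma reward_hitsE g (rho : run_space M) :
  g (reach_reward T r rho) =
  g 0 + \sum_(t in T) (g (ratr (r t)) - g 0) * \1_(hits T t) rho.
Proof.
have [h|h] := pselect (reaches T rho).
  have [t tT ht] := reaches_hits h.
  by rewrite (sum_indic_hits _ tT ht) (reach_reward_hits tT ht) addrC subrK.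
by rewrite sum_indic_nohits// addr0 /reach_reward; case: pselect.
Qed.

Let reward_hitsEFin g : (fun rho : run_space M => (g (reach_reward T r rho))%:E) =
  (cst (g 0)%:E \+ fun rho =>
    (\sum_(t in T) (g (ratr (r t)) - g 0) * \1_(hits T t) rho)%:E)%E.
Proof. by apply/funext => rho; rewrite reward_hitsE EFinD. Qed.

Lemma integrable_reward sigma g :
  (run_prob sigma).-integrable setT (fun rho => (g (reach_reward T r rho))%:E).
Proof.
rewrite reward_hitsEFin; apply: integrableD => //; last exact: integrable_hits.
exact: finite_measure_integrable_cst.
Qed.

Lemma integral_reward sigma g :
  (\int[run_prob sigma]_rho (g (reach_reward T r rho))%:E = (mean sigma g)%:E)%E.
Proof.
rewrite reward_hitsEFin integralD//; last 2 first.
- exact: finite_measure_integrable_cst.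
- exact: integrable_hits.
by rewrite integral_hits integral_cst//= probability_setT mule1 meanE.
Qed.

(** The stochastic order. Its instances for the identity, a negated indicator of a lower half-line
    and a negated positive part give expectation, distribution function and [ru]. *)
Lemma ler_mean sigma sigma' g :
  attraction T r -> (forall t, t \in T -> hit T sigma t <= hit T sigma' t) ->
  {homo g : x y / x <= y} -> mean sigma g <= mean sigma' g.
Proof.
move=> attr hits gh; rewrite !meanE lerD2l; case: attr => [reach|r0].
  have sum1 tau : \sum_(t in T) hit T tau t = 1.
    by apply: EFin_inj; rewrite sum_hit reach.
  (* Nonnegative differences with sum 0 all vanish. *)
  have eq0 : \sum_(t in T) (hit T sigma' t - hit T sigma t) = 0.
    by rewrite sumrB !sum1 subrr.
  rewrite le_eqVlt; apply/orP; left; apply/eqP; apply: eq_bigr => t tT.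
  congr (_ * _); apply/esym/eqP; rewrite -subr_eq0; apply/eqP.
  by apply: (psumr_eq0P _ eq0) => // s sT; rewrite subr_ge0 hits.
apply: ler_sum => t tT; rewrite ler_wpM2l ?hits// subr_ge0 gh//.
by rewrite ler0q r0.
Qed.

Lemma run_prob_reward sigma (B : set R) : measurable B ->
  (run_prob sigma (reach_reward T r @^-1` B) = (mean sigma (\1_B))%:E)%E.
Proof.
move=> mB; have mX : measurable (reach_reward T r @^-1` B : set (run_space M)).
  by rewrite -[X in measurable X]setTI; exact: measurable_reach_reward.
rewrite -[X in run_prob _ X]setIT -integral_indic// -integral_reward.
by apply: eq_integral => rho _; rewrite !indicE.
Qed.

Lemma reach_EE sigma : reach_E T r sigma = (mean sigma id)%:E.
Proof. by rewrite /reach_E expectation_def -integral_reward. Qed.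

Lemma cdfE sigma x :
  cdf (reward_rv T r sigma) x = (fcdf (law sigma) outcome x)%:E.
Proof.
rewrite /cdf /distribution /pushforward run_prob_reward//; congr EFin.
rewrite /mean /fcdf [RHS]big_mkcond/=; apply: eq_bigr => o _.
by rewrite indicE/= mem_setE in_itv/=; case: ifP; rewrite ?mulr1 ?mulr0.
Qed.

Lemma reach_VaRE sigma q :
  reach_VaR T r sigma q = sup [set x | fcdf (law sigma) outcome x <= q].
Proof.
rewrite /reach_VaR /VaR; congr sup; apply/seteqP.
by split => x /=; rewrite cdfE lee_fin.
Qed.

(** With [v] the value at risk, the truncated integral plus [(p - P[X < v]) * v] equals [p * v]
    minus the mean of [Num.max (v - X) 0]. *)
Lemma reach_CVaRE sigma p :
  reach_CVaR T r sigma p =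
  (p^-1 * ru (law sigma) outcome p (reach_VaR T r sigma p))%:E.
Proof.
rewrite /reach_CVaR /CVaR -/(reach_VaR T r sigma p).
set v := reach_VaR T r sigma p.
have -> : (\int[distribution (run_prob sigma) (reward_rv T r sigma)]_(x in
      `]-oo, v[) x%:E =
    (mean sigma (fun x => if x < v then x else 0))%:E)%E.
  rewrite integral_pushforward//; last first.
    apply: integrableS (integrable_reward sigma id) => //.
    rewrite -[X in measurable X]setTI; exact: measurable_reach_reward.
  rewrite integral_mkcond -integral_reward; apply: eq_integral => rho _.
  rewrite patchE /=; case: ifPn; rewrite ?inE ?notin_setE /= in_itv/=.
    by move=> ->.
  by move/negP/negbTE => ->.
have -> : (run_prob sigma [set rho | (reward_rv T r sigma rho < v)%R] =
    (mean sigma (fun x => (x < v)%R%:R))%:E)%E.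
  have := @run_prob_reward sigma `]-oo, v[%classic (measurable_itv _).
  rewrite (_ : _ @^-1` _ = [set rho | (reward_rv T r sigma rho < v)%R]); last first.
    by apply/seteqP; split => rho /=; rewrite in_itv.
  move=> ->; congr EFin; apply: eq_bigr => o _.
  by rewrite indicE mem_setE in_itv.
rewrite -EFinB -EFinM; congr EFin; congr (_ * _).
rewrite /ru /mean mulrBl addrCA; congr (_ + _).
rewrite mulr_suml -sumrB -sumrN; apply: eq_bigr => o _.
by rewrite maxEle subr_le0; case: ltP => _ /=; ring.
Qed.

End reward_law.

(** * Comparison of the three objectives *)

Section domination.
Context (R : realType) (M : mdp R) (T : {set state M}) (r : state M -> rat).
Variables sigma sigma' : strategy M.
Hypothesis attr : attraction T r.
Hypothesis hits_le : forall t, t \in T -> hit T sigma t <= hit T sigma' t.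
Local Notation outcome := (outcome r).
Local Notation law := (law T).

Lemma le_reach_E : (reach_E T r sigma <= reach_E T r sigma')%E.
Proof. by rewrite !reach_EE lee_fin ler_mean. Qed.

Lemma ge_fcdf_law c : fcdf (law sigma') outcome c <= fcdf (law sigma) outcome c.
Proof.
have fE tau : fcdf (law tau) outcome c = mean T r tau (fun x => (x <= c)%R%:R).
  rewrite /fcdf big_mkcond; apply: eq_bigr => o _.
  by case: ifP; rewrite ?mulr1 ?mulr0.
rewrite !fE -lerN2 -!meanN ler_mean// => x y xy; rewrite lerN2.
by case: (leP y c) => // yc; rewrite (le_trans xy yc).
Qed.

Lemma le_ru_law p c : ru (law sigma) outcome p c <= ru (law sigma') outcome p c.
Proof.
rewrite /ru lerD2l -!(meanN T r _ (fun x => Num.max (c - x) 0)) ler_mean// => x y xy.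
by rewrite lerN2 ge_max !le_max lexx orbT lerD2l lerN2 xy.
Qed.

Lemma le_reach_VaR q : 0 < q < 1 -> reach_VaR T r sigma q <= reach_VaR T r sigma' q.
Proof.
move=> q01; rewrite !reach_VaRE.
have hs tau : has_sup [set x | fcdf (law tau) outcome x <= q].
  by apply: has_sup_fcdf; [exact: sum_law|lra].
apply: ge_sup; first exact: (hs sigma).1.
move=> c /= cq; apply: ub_le_sup; first exact: (hs sigma').2.
exact: le_trans (ge_fcdf_law c) cq.
Qed.

Lemma le_reach_CVaR p : 0 < p < 1 ->
  (reach_CVaR T r sigma p <= reach_CVaR T r sigma' p)%E.
Proof.
move=> p01; rewrite !reach_CVaRE lee_fin ler_wpM2l//.
  by rewrite invr_ge0; lra.
(* Both functionals are compared at the value at risk of [sigma]; that of [sigma'] is then raised to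
   its maximum, attained at its own value at risk. *)
apply: (le_trans (le_ru_law _ _)); rewrite [in leRHS]reach_VaRE.
by apply: ru_max_sup => //; [exact: law_ge0|exact: sum_law].
Qed.

End domination.

Theorem theorem5p4 (R : realType) (M : mdp R) (T : {set state M})
    (r : state M -> rat)
    (T_absorbing : absorbing T) (T_attraction : attraction T r) :
  (forall sigma : strategy M, exists sigma' : strategy M,
     [/\ memoryless sigma',
         (reach_E T r sigma <= reach_E T r sigma')%E,
         forall q : R, 0 < q < 1 ->
           reach_VaR T r sigma q <= reach_VaR T r sigma' q
       & forall p : R, 0 < p < 1 ->
           (reach_CVaR T r sigma p <= reach_CVaR T r sigma' p)%E]) /\
  (forall e q v p c : R, 0 < q < 1 -> 0 < p < 1 ->
     (exists sigma : strategy M, satisfies_query T r sigma e q v p c) ->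
     exists sigma' : strategy M,
       memoryless sigma' /\ satisfies_query T r sigma' e q v p c).
Proof.
(* The strategy is chosen from hitting probabilities alone, so it serves all levels [p] and [q] at
   once. *)
split=> [sigma|e q v p c q01 p01 [sigma [eE vV cC]]];
  have [sigma' [mem hits]] := memoryless_hit T sigma; exists sigma'.
  by split=> //; [exact: le_reach_E|exact: le_reach_VaR|exact: le_reach_CVaR].
split=> //; split.
- exact: le_trans eE (le_reach_E T_attraction hits).
- exact: le_trans vV (le_reach_VaR T_attraction hits q01).
- exact: le_trans cC (le_reach_CVaR T_attraction hits p01).
Qed.
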